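(* Let $\lambda,\mu\in[0,1]$ with $\mu<\lambda$, and let $f=f(x,T,t)$ be a solution of the kinetic equation $\partial_t f=\mathcal L(f)+Q(f,f)$ defined in the context. Then the first temperature moment $M_1(t)=\int_\Omega f(x,T,t)\,T\,d\omega$ satisfies $$\frac{dM_1}{dt}=(\mu-\lambda)\int_{\Omega\times\Omega}(T-T_* )\,\chi_{\mathcal F}(x,x_*,T,T_* )\,f f_*\,d\omega\,d\omega_*\le 0,$$ where $f=f(x,T,t)$ and $f_*=f(x_*,T_*,t)$.
   Context: $\mathcal D\subseteq\mathbb R^d$, $d\geq 1$; $\mathcal F:\mathcal D\to\mathbb R$ is continuous; $\Omega=\mathcal D\times\mathbb R^+$, $\omega=(x,T)$, $d\omega=dx\,dT$ (similarly $\omega_*=(x_*,T_* )$); $f(\cdot,\cdot,t)$ is a probability density on $\Omega$. Interaction indicator: $\chi_{\mathcal F}(x,x_*,T,T_* )=\Psi(\mathcal F(x)<\mathcal F(x_* ))\,\Psi(T_*<T)$, with $\Psi(\cdot)$ equal to $1$ if its argument is true and $0$ otherwise. Binary temperature interaction between $(x,T)$ and $(x_*,T_* )$: $$T'=T-\lambda(T-T_* )\chi_{\mathcal F}(x,x_*,T,T_* )-\mu(T-T_* )\chi_{\mathcal F}(x_*,x,T_*,T)+\sigma(x,x_*,T,T_* )\zeta,$$ $$T_*'=T_*-\lambda(T_*-T)\chi_{\mathcal F}(x_*,x,T_*,T)-\mu(T_*-T)\chi_{\mathcal F}(x,x_*,T,T_* )+\sigma(x_*,x,T_*,T)\zeta_*,$$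 where $\sigma$ is the noise intensity and $\zeta,\zeta_*$ are symmetric random variables with mean zero. The interaction operator $Q$ is defined in weak form, with $\mathbb E$ the expectation over $\zeta,\zeta_*$, by $$\int_\Omega Q(f,f)\varphi\,d\omega=\mathbb E\left[\int_{\Omega\times\Omega}\big(\varphi(x,T')-\varphi(x,T)\big)f f_*\,d\omega\,d\omega_*\right].$$ The exploration operator $\mathcal L$ is defined in weak form by $$\int_\Omega\mathcal L(f)\varphi\,d\omega=\mathbb E\left[\int_\Omega\mathcal B_{\mathcal F}(x\to x',T)\big(\varphi(x',T)-\varphi(x,T)\big)f(x,T,t)\,d\omega\right],$$ where $x'=x+\eta(T)\xi$ with $\eta$ a given function, $\mathbb E$ is here the expectation over $\xi$ with symmetric density $p(\xi,T)$ on $\mathbb R^d$, $\mathcal B_{\mathcal F}(x\to x',T)=\min\{1,e^{-(\mathcal F(x')-\mathcal F(x))/T}\}$, and moves with $x'\notin\mathcal D$ are rejected (contribute zero). A solution $f$ satisfies $\frac{d}{dt}\int_\Omega f\varphi\,d\omega=\int_\Omega\mathcal L(f)\varphi\,d\omega+\int_\Omega Q(f,f)\varphi\,d\omega$ for test functions $\varphi$; it is assumed regular and integrable enough that $\varphi(x,T)=T$ is an admissible test function, with all integrals involved absolutely convergent (including in the noise variables). *)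

(* Defs.v *)
From HB Require Import structures.
From mathcomp Require Import all_boot all_order all_algebra.
From mathcomp Require Import all_classical all_reals all_analysis.

Set Implicit Arguments.
Unset Strict Implicit.
Unset Printing Implicit Defensive.

Import Order.TTheory GRing.Theory Num.Theory.
Import numFieldTopology.Exports numFieldNormedType.Exports.

Local Open Scope classical_set_scope.
Local Open Scope ring_scope.

(* The library's sigma-finite structure on [m1 \x m2] is shadowed, for
   canonical structure inference, by the one for subprobabilities; it is
   restored here under a new name so that products can be iterated. *)
Section product_sigma_finite.
Context d1 d2 (T1 : measurableType d1) (T2 : measurableType d2) (R : realType).
Variable m1 : {sigma_finite_measure set T1 -> \bar R}.
Variable m2 : {sigma_finite_measure set T2 -> \bar R}.

Definition sf_product : set (T1 * T2) -> \bar R := (m1 \x m2)%E.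

HB.instance Definition _ := Measure.on sf_product.

Let sf_product_sigma_finite : sigma_finite setT sf_product.
Proof.
have /sigma_finiteP[F [TF ndF Foo]] := sigma_finiteT m1.
have /sigma_finiteP[G [TG ndG Goo]] := sigma_finiteT m2.
exists (fun n => F n `*` G n).
  rewrite -setXTT TF TG predeqE => -[x y]; split.
    move=> [/= [n _ Fnx] [k _ Gky]]; exists (maxn n k) => //; split.
    - by move: x Fnx; exact/subsetPset/ndF/leq_maxl.
    - by move: y Gky; exact/subsetPset/ndG/leq_maxr.
  by move=> [n _ []/= ? ?]; split; exists n.
move=> k; have [? ?] := Foo k; have [? ?] := Goo k.
split; first exact: measurableX.
by rewrite /sf_product product_measure1E// lte_mul_pinfty// ge0_fin_numE.
Qed.

HB.instance Definition _ := Measure_isSigmaFinite.Build _ _ _ sf_product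
  sf_product_sigma_finite.

End product_sigma_finite.

(* Row vectors carry the sigma-algebra generated by the coordinate maps, as
   the library does for tuples; for R^n this is the Borel sigma-algebra. *)
Section measurable_row.
Context {d} {T : measurableType d} (n : nat).

Let coord (i : 'I_n) (v : 'rV[T]_n) : T := v ord0 i.

Let row_set0 : g_sigma_preimage coord set0.
Proof. exact: sigma_algebra0. Qed.

Let row_setC A : g_sigma_preimage coord A -> g_sigma_preimage coord (~` A).
Proof. exact: sigma_algebraC. Qed.

Let row_bigcup (F : _^nat) : (forall i, g_sigma_preimage coord (F i)) ->
  g_sigma_preimage coord (\bigcup_i (F i)).
Proof. exact: sigma_algebra_bigcup. Qed.

HB.instance Definition _ := @isMeasurable.Build (measure_tuple_display d)
  'rV[T]_n (g_sigma_preimage coord) row_set0 row_setC row_bigcup.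

Lemma measurable_coord (i : 'I_n) :
  measurable_fun [set: 'rV[T]_n] (fun v : 'rV[T]_n => v ord0 i).
Proof.
move=> _ Y mY; rewrite setTI; apply: sub_sigma_algebra => /=.
rewrite -bigcup_seq/=; exists i => /=; first by rewrite mem_index_enum.
by exists Y => //; rewrite setTI.
Qed.

Lemma measurable_fun_row d' (T' : measurableType d') (f : T' -> 'rV[T]_n) :
  (forall i, measurable_fun setT (fun x => f x ord0 i)) -> measurable_fun setT f.
Proof.
move=> mf.
have : g_sigma_preimage coord `<=` [set A | measurable (f @^-1` A)].
  apply: smallest_sub.
    split=> [|A mA|F mF] /=.
    - by rewrite preimage_set0; exact: measurable0.
    - by rewrite setTD preimage_setC; exact: measurableC.
    - by rewrite preimage_bigcup; apply: bigcup_measurable => k _; exact: mF.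
  move=> A; rewrite -bigcup_seq => -[i _] [B mB <-] /=.
  have := mf i measurableT B mB.
  by rewrite !setTI.
by move=> sub _ A mA; rewrite setTI; exact: sub.
Qed.

End measurable_row.

(* Lebesgue measure on R^n: pushforward of the product of n copies of the
   Lebesgue measure on R. *)
Section lebesgue_row.
Context {R : realType}.

Definition row_cons n (p : measurableTypeR R * 'rV[R]_n) : 'rV[R]_n.+1 :=
  \row_i oapp (p.2 ord0) p.1 (unlift ord0 i).

Definition row_uncons n (v : 'rV[R]_n.+1) : measurableTypeR R * 'rV[R]_n :=
  (v ord0 ord0, \row_i v ord0 (lift ord0 i)).

Lemma row_cons0 n (p : measurableTypeR R * 'rV[R]_n) : row_cons p ord0 ord0 = p.1.
Proof. by rewrite mxE unlift_none. Qed.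

Lemma row_consS n (p : measurableTypeR R * 'rV[R]_n) i :
  row_cons p ord0 (lift ord0 i) = p.2 ord0 i.
Proof. by rewrite mxE liftK. Qed.

Lemma row_consK n : cancel (@row_cons n) (@row_uncons n).
Proof.
move=> -[a v]; rewrite /row_uncons row_cons0; congr pair.
by apply/rowP => i; rewrite mxE row_consS.
Qed.

Lemma measurable_row_cons n : measurable_fun setT (@row_cons n).
Proof.
apply: measurable_fun_row => i; have [j ->|->] := unliftP ord0 i.
  rewrite (_ : (fun _ => _) = (fun v : 'rV[R]_n => v ord0 j) \o snd).
    by apply: measurableT_comp => //; exact: measurable_coord.
  by apply/funext => p; rewrite row_consS.
by under eq_fun do rewrite row_cons0; exact: measurable_fst.
Qed.

Lemma measurable_row_uncons n : measurable_fun setT (@row_uncons n).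
Proof.
apply: measurable_fun_pair; first exact: measurable_coord.
apply: measurable_fun_row => i; under eq_fun do rewrite mxE.
exact: measurable_coord.
Qed.

Section row_cons_measure.
Variables (n : nat) (mu : {sigma_finite_measure set 'rV[R]_n -> \bar R}).

Definition row_cons_measure : set 'rV[R]_n.+1 -> \bar R :=
  pushforward (sf_product lebesgue_measure mu) (@row_cons n).

Let row_cons_measure0 : row_cons_measure set0 = 0%E.
Proof. by rewrite /row_cons_measure /pushforward preimage_set0 measure0. Qed.

Let row_cons_measure_ge0 A : (0 <= row_cons_measure A)%E.
Proof. by rewrite /row_cons_measure /pushforward measure_ge0. Qed.

Let row_cons_measure_sigma_additive : semi_sigma_additive row_cons_measure.
Proof.
move=> F mF tF mUF; rewrite /row_cons_measure /pushforward preimage_bigcup.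
apply: measure_sigma_additive.
  by move=> k; rewrite -[X in measurable X]setTI; exact: measurable_row_cons.
apply/trivIsetP => i j _ _ ij.
by move/trivIsetP : tF => /(_ i j I I ij) tF; rewrite -preimage_setI tF preimage_set0.
Qed.

HB.instance Definition _ := isMeasure.Build _ _ _ row_cons_measure
  row_cons_measure0 row_cons_measure_ge0 row_cons_measure_sigma_additive.

Let row_cons_measure_sigma_finite : sigma_finite setT row_cons_measure.
Proof.
have [F FT Foo] := sigma_finiteT (sf_product lebesgue_measure mu).
exists (fun k => @row_uncons n @^-1` F k).
  by rewrite -preimage_bigcup -FT preimage_setT.
move=> k; have [mF Fk] := Foo k; split.
  by rewrite -[X in measurable X]setTI; exact: measurable_row_uncons.
rewrite /row_cons_measure /pushforward -comp_preimage.
by rewrite (_ : _ \o _ = id) // funeqE; exact: row_consK.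
Qed.

HB.instance Definition _ := Measure_isSigmaFinite.Build _ _ _ row_cons_measure
  row_cons_measure_sigma_finite.

End row_cons_measure.

Fixpoint lebesgue_row n : {sigma_finite_measure set 'rV[R]_n -> \bar R} :=
  if n is n'.+1 return {sigma_finite_measure set 'rV[R]_n -> \bar R}
  then row_cons_measure (lebesgue_row n') else \d_(0 : 'rV[R]_0).

End lebesgue_row.

Lemma lebesgue_row_box {R : realType} n (A : 'I_n -> set (measurableTypeR R)) :
  (forall i, measurable (A i)) ->
  lebesgue_row n [set v : 'rV[R]_n | forall i, A i (v ord0 i)] =
  (\prod_i lebesgue_measure (A i))%E.
Proof.
elim: n A => [|n IHn] A mA.
  rewrite big_ord0 /= diracE (_ : [set _ | _] = setT) ?in_setT//.
  by apply/seteqP; split => // v _ [].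
rewrite big_ord_recl /= /row_cons_measure /pushforward.
have mB : measurable [set v : 'rV[R]_n | forall i, A (lift ord0 i) (v ord0 i)].
  rewrite (_ : [set _ | _] = \big[setI/setT]_(i < n)
      ((fun v : 'rV[R]_n => v ord0 i) @^-1` A (lift ord0 i))).
    apply: bigsetI_measurable => i _.
    have := @measurable_coord _ R n i measurableT (A (lift ord0 i)) (mA _).
    by rewrite setTI.
  apply/seteqP; split => v /=.
    by move=> Av; rewrite -bigcap_seq => i _; exact: Av.
  by rewrite -bigcap_seq => Av i; apply: Av; rewrite /= mem_index_enum.
rewrite -IHn// -product_measure1E//; congr (_ _).
apply/seteqP; split=> [[a v]/= Av|[a v]/= [Aa Av] i].
  by split=> [|i]; [have := Av ord0; rewrite row_cons0
                   |have := Av (lift ord0 i); rewrite row_consS].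
by have [j ->|->] := unliftP ord0 i; rewrite ?row_consS ?row_cons0//=; exact: Av.
Qed.

Section kinetic_model.
Context {R : realType} {d : nat}.
Implicit Types (x y xi : 'rV[R]_d) (T : R) (D : set 'rV[R]_d).
Implicit Types (F : 'rV[R]_d -> R) (lambda mu : R).

Local Notation phase := ('rV[R]_d * measurableTypeR R)%type.

Definition dphase : {sigma_finite_measure set phase -> \bar R} :=
  sf_product (lebesgue_row d) lebesgue_measure.

Definition dphase2 : {sigma_finite_measure set (phase * phase)%type -> \bar R} :=
  sf_product dphase dphase.

Definition Omega D : set phase := D `*` `]0%R, +oo[.

Definition chi F x y T Ty : R := ((F x < F y) && (Ty < T))%:R.

Definition interaction lambda mu F (sigma : 'rV[R]_d -> 'rV[R]_d -> R -> R -> R)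
    x y T Ty (z zy : R) : R * R :=
  (T - lambda * (T - Ty) * chi F x y T Ty - mu * (T - Ty) * chi F y x Ty T
     + sigma x y T Ty * z,
   Ty - lambda * (Ty - T) * chi F y x Ty T - mu * (Ty - T) * chi F x y T Ty
     + sigma y x Ty T * zy).

Definition probability_density D (g : phase -> R) : Prop :=
  [/\ measurable_fun (Omega D) g, (forall w, Omega D w -> 0 <= g w) &
      (\int[dphase]_(w in Omega D) (g w)%:E = 1)%E].

Definition symmetric_density (q : 'rV[R]_d -> R) : Prop :=
  [/\ measurable_fun setT q, (forall xi, 0 <= q xi),
      (\int[lebesgue_row d]_xi (q xi)%:E = 1)%E & forall xi, q (- xi) = q xi].

Definition symmetric_rv dW (W : measurableType dW) (P : probability W R)
    (Z : {RV P >-> R}) : Prop :=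
  forall A : set R, measurable A -> P (Z @^-1` A) = P ((\- Z) @^-1` A).

Definition mean_zero dW (W : measurableType dW) (P : probability W R)
    (Z : {RV P >-> R}) : Prop :=
  P.-integrable setT (EFin \o Z) /\ ('E_P[Z] = 0)%E.

Section interaction_operator.
Context {dW : measure_display} {W : measurableType dW} (P : probability W R).
Variables (D : set 'rV[R]_d) (F : 'rV[R]_d -> R) (lambda mu : R).
Variables (sigma : 'rV[R]_d -> 'rV[R]_d -> R -> R -> R).
Variables (Z Zs : {RV P >-> R}) (g phi : phase -> R).

Definition Q_integrand (u : W) (w : phase * phase) : R :=
  let x := w.1.1 in let T := w.1.2 in let xs := w.2.1 in let Ts := w.2.2 in
  let T' := (interaction lambda mu F sigma x xs T Ts (Z u) (Zs u)).1 in
  (phi (x, T') - phi (x, T)) * g w.1 * g w.2.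

(* The weak form of Q(g, g), tested against phi; the operator itself is only
   defined through it. *)
Definition Q_weak : R :=
  fine ('E_P[(fun u => \int[dphase2]_(w in Omega D `*` Omega D)
    Q_integrand u w)%R])%E.

Definition Q_converges : Prop :=
  (P \x dphase2)%E.-integrable (setT `*` (Omega D `*` Omega D))
    (fun uw => (Q_integrand uw.1 uw.2)%:E).

End interaction_operator.

Section exploration_operator.
Variables (D : set 'rV[R]_d) (F : 'rV[R]_d -> R) (eta : R -> R).
Variables (p : 'rV[R]_d -> R -> R) (g phi : phase -> R).

Definition metropolis x x' T : R := Num.min 1 (expR (- (F x' - F x) / T)).

(* The factor \1_D x' rejects the moves leaving D; the density p(xi, T) of
   the law of xi depends on T, so it is part of the integrand. *)
Definition L_integrand xi (w : phase) : R :=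
  let x := w.1 in let T := w.2 in let x' := x + eta T *: xi in
  \1_D x' * metropolis x x' T * (phi (x', T) - phi (x, T)) * g w * p xi T.

Definition L_weak : R :=
  \int[lebesgue_row d]_xi \int[dphase]_(w in Omega D) L_integrand xi w.

Definition L_converges : Prop :=
  (lebesgue_row d \x dphase)%E.-integrable (setT `*` Omega D)
    (fun xw => (L_integrand xw.1 xw.2)%:E).

End exploration_operator.

(* f is a solution, for positive times, with respect to the class Phi of
   test functions, for which all integrals converge absolutely (jointly in the
   noise variables).  Test functions are defined on R^d x R, because
   the noise may move T' out of the positive half-line. *)
Definition kinetic_solution dW (W : measurableType dW) (P : probability W R)
    D F lambda mu (sigma : 'rV[R]_d -> 'rV[R]_d -> R -> R -> R)
    (Z Zs : {RV P >-> R}) (eta : R -> R) (p : 'rV[R]_d -> R -> R)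
    (Phi : set (phase -> R)) (f : R -> phase -> R) : Prop :=
  forall t, 0 < t ->
    probability_density D (f t) /\
    forall phi, Phi phi ->
      [/\ dphase.-integrable (Omega D) (fun w => (f t w * phi w)%:E),
          L_converges D F eta p (f t) phi,
          Q_converges D F lambda mu sigma Z Zs (f t) phi &
          is_derive t 1 (fun s => \int[dphase]_(w in Omega D) (f s w * phi w))
            (L_weak D F eta p (f t) phi +
             Q_weak D F lambda mu sigma Z Zs (f t) phi)].

Definition temperature_moment D (f : R -> phase -> R) (t : R) : R :=
  \int[dphase]_(w in Omega D) (f t w * w.2).

End kinetic_model.

(* Main.v *)
Require Import Defs.
From mathcomp Require Import all_boot all_order all_algebra.
From mathcomp Require Import all_classical all_reals all_analysis.
From mathcomp Require Import measurable_realfun ring.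

(** Take phi(x, T) = T as a test function.

    Exploration moves x and leaves T alone, so phi(x', T) - phi(x, T) = 0 and
    the exploration operator contributes nothing ([L_weak_temperature]).

    In the interaction operator, T' - T is a drift plus sigma times a centred
    noise.  Integrating first in the noise, which Fubini permits because the
    whole integrand is jointly integrable, kills the noise term at each fixed
    pair (w, w_* ) and leaves the drift
    ([expectation_Rintegral_affine_noise]).  Write
    k(w, w_* ) = (T - T_* ) chi(x, x_*, T, T_* ) f f_*.  Up to the exchange of
    the two particles the two drift terms are the same function: the drift
    weighted by f f_* is mu k(w_*, w) - lambda k(w, w_* ).  The exchange preserves dw dw_*, so its
    integral is (mu - lambda) times that of k
    ([integral_antisymmetrization]).  Since chi vanishes unless T_* < T, k is
    nonnegative and the sign follows from mu < lambda.

    The point needing care is that Fubini gives integrability only of the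
    whole weighted drift, while splitting its integral needs that of k.  It comes from
    the disjointness of supports: chi(x, x_*, T, T_* ) and
    chi(x_*, x, T_*, T) cannot both be 1, so lambda k is the negative part of
    the weighted drift, hence measurable and integrable along with it. *)

Set Implicit Arguments.
Unset Strict Implicit.
Unset Printing Implicit Defensive.

Import Order.TTheory GRing.Theory Num.Theory.
Import numFieldTopology.Exports numFieldNormedType.Exports.
Local Open Scope classical_set_scope.
Local Open Scope ring_scope.

Lemma integrable_fubini_G (R : realType) (d1 d2 : measure_display)
    (T1 : measurableType d1) (T2 : measurableType d2)
    (m1 : {sigma_finite_measure set T1 -> \bar R})
    (m2 : {sigma_finite_measure set T2 -> \bar R}) (h : T1 * T2 -> \bar R) :
  (m1 \x m2)%E.-integrable setT h -> m2.-integrable setT (fubini_G m1 h).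
Proof.
move=> ih; have mh := measurable_int _ ih.
apply/integrableP; split; first exact: measurable_fubini_G ih.
apply: le_lt_trans ((integrable21ltyP m1 m2 mh).1 ih).
apply: ge0_le_integral => //.
- by apply: measurableT_comp => //; exact: measurable_fubini_G ih.
- apply: (measurable_fun_fubini_tonelli_G (abse \o h)) => //=.
  exact: measurableT_comp.
- move=> y _; apply: le_abse_integral => //.
  by apply: measurableT_comp => //; exact: pair2_measurable.
Qed.

(** Fubini applied to an integrand affine in a centred noise Z.  At fixed w the
    noise term has mean zero because Z itself is integrable, so averaging over
    the noise returns a w exactly.  Hence a is a marginal of a jointly
    integrable function, which is why its integrability is a conclusion. *)
Lemma expectation_Rintegral_affine_noise (R : realType)
    (dW : measure_display) (W : measurableType dW) (P : probability W R)
    (Z : {RV P >-> R}) (dX : measure_display) (X : measurableType dX)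
    (m : {sigma_finite_measure set X -> \bar R}) (A : set X) (a b : X -> R) :
  measurable A -> mean_zero Z ->
  (P \x m)%E.-integrable (setT `*` A)
    (fun uw => (a uw.2 + b uw.2 * Z uw.1)%:E) ->
  m.-integrable A (EFin \o a) /\
  ('E_P[(fun u => \int[m]_(w in A) (a w + b w * Z u))%R] =
   \int[m]_(w in A) (a w)%:E)%E.
Proof.
move=> mA [iZ EZ] /integrable_mkcond; set h := (X in _.-integrable _ X) => ih.
have {}ih : (P \x m)%E.-integrable setT h by apply: ih; exact: measurableX.
have hE u w : h (u, w) =
    ((fun w => (a w + b w * Z u)%:E) \_ A) w.
  by rewrite /h !patchE in_setX in_setT.
have meanE w : fubini_G P h w = ((EFin \o a) \_ A) w.
  rewrite /fubini_G patchE; case: ifPn => wA; last first.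
    by rewrite integral0_eq// => u _; rewrite hE patchE (negbTE wA).
  under eq_integral do rewrite hE patchE wA EFinD EFinM.
  rewrite integralD//;
    [|exact: finite_measure_integrable_cst|exact: integrableZl].
  rewrite integral_cst// integralZl//.
  rewrite [X in (_ * X + _)%E](probability_setT P) mule1.
  by move: EZ; rewrite unlock => ->; rewrite mule0 adde0.
have ia : m.-integrable setT ((EFin \o a) \_ A).
  have := integrable_fubini_G ih.
  by apply: eq_integrable => // w _; rewrite meanE.
split; first exact/integrable_mkcond.
rewrite [RHS]integral_mkcond -(eq_integral _ _ (fun w _ => meanE w)).
rewrite (integral21_prod_meas1 ih) -(integral12_prod_meas1 ih) unlock.
(* The real-valued inner integral truncates infinite values to 0; by Fubini
   these occur only for a null set of noise values. *)
apply: ae_eq_integral => //.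
- rewrite (_ : (fun _ => _) = EFin \o fine \o fubini_F m h).
    apply: measurableT_comp; last exact: measurable_fubini_F ih.
    exact/measurable_EFinP/fine_measurable.
  apply/funext => u /=; rewrite /Rintegral integral_mkcond.
  by congr (fine _)%:E; apply: eq_integral => w _; rewrite hE.
- exact: measurable_fubini_F ih.
have := ae_integrable1 ih; apply: filterS => u iu _ /=.
rewrite /Rintegral fineK.
  by rewrite integral_mkcond; apply: eq_integral => w _; rewrite hE.
apply: integrable_fin_num => //; apply/integrable_mkcond => //.
by apply: eq_integrable iu => // w _; rewrite hE.
Qed.

Lemma ge0_integral_swap (R : realType) (dX : measure_display)
    (X : measurableType dX) (m : {sigma_finite_measure set X -> \bar R})
    (k : X * X -> \bar R) :
  measurable_fun setT k -> (forall z, 0 <= k z)%E ->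
  (\int[sf_product m m]_z k (swap_pair z) = \int[sf_product m m]_z k z)%E.
Proof.
move=> mk k0.
rewrite (@fubini_tonelli1 _ _ _ _ _ m m k mk k0).
rewrite (@fubini_tonelli2 _ _ _ _ _ m m (k \o swap_pair)) => [//||z];
  last exact: k0.
by apply: measurableT_comp => //; exact: measurable_swap.
Qed.

(** The two halves of the left-hand side are exchanged by the swap, which
    preserves the product measure.  The splitting is legitimate because k and
    its swap have disjoint supports, so that lambda k is the negative part of
    an integrable function; dividing by lambda > 0 gives k integrable. *)
Lemma integral_antisymmetrization (R : realType) (dX : measure_display)
    (X : measurableType dX) (m : {sigma_finite_measure set X -> \bar R})
    (A : set X) (k : X * X -> R) (lambda mu : R) :
  measurable A -> (forall z, (A `*` A) z -> 0 <= k z) ->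
  (forall z, (A `*` A) z -> k z * k (swap_pair z) = 0) ->
  0 < lambda -> 0 <= mu ->
  (sf_product m m).-integrable (A `*` A)
    (fun z => (mu * k (swap_pair z) - lambda * k z)%:E) ->
  \int[sf_product m m]_(z in A `*` A) (mu * k (swap_pair z) - lambda * k z) =
  (mu - lambda) * \int[sf_product m m]_(z in A `*` A) k z.
Proof.
move=> mA k0 kk l0 mu0 ih.
have mAA : measurable (A `*` A) by exact: measurableX.
pose K := k \_ (A `*` A).
have K0 z : 0 <= K z.
  by rewrite /K patchE; case: ifPn => // /set_mem/k0.
have KK z : K z * K (swap_pair z) = 0.
  rewrite /K !patchE; case: ifPn => [/set_mem zA|_]; last by rewrite mul0r.
  rewrite ifT ?kk//; apply/mem_set.
  by case: z zA => x y [].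
have hE : (fun z => (mu * k (swap_pair z) - lambda * k z)%:E) \_ (A `*` A) =
    (fun z => (mu * K (swap_pair z) - lambda * K z)%:E).
  apply/funext => -[x y].
  rewrite /K !patchE /swap_pair/= !in_setX [in RHS]andbC.
  by rewrite andbC; case: ifPn; rewrite // !mulr0 subrr.
have {}ih : (sf_product m m).-integrable setT
    (fun z => (mu * K (swap_pair z) - lambda * K z)%:E).
  by rewrite -hE; exact: (integrable_mkcond _ mAA).1 ih.
(* K and its swap are nonnegative and never both nonzero, so lambda K is
   exactly the negative part of the combination. *)
have negE : (fun z => (mu * K (swap_pair z) - lambda * K z)%:E)^\-%E =
    (fun z => lambda%:E * (K z)%:E)%E.
  apply/funext => z; rewrite funenegE -EFinN -EFin_max -EFinM; congr EFin.
  have /eqP := KK z; rewrite mulf_eq0 => /orP[]/eqP ->.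
    by rewrite mulr0 subr0 max_r// oppr_le0 mulr_ge0.
  by rewrite mulr0 sub0r opprK max_l// mulr_ge0// ltW.
have iK : (sf_product m m).-integrable setT (EFin \o K).
  have := integrable_funeneg measurableT ih.
  rewrite negE => /(integrableZl measurableT lambda^-1).
  apply: eq_integrable => // z _ /=.
  by rewrite -!EFinM mulrA mulVf ?gt_eqF// mul1r.
have mK := measurable_int _ iK.
have swapE : (\int[sf_product m m]_z (K (swap_pair z))%:E =
    \int[sf_product m m]_z (K z)%:E)%E.
  by rewrite (@ge0_integral_swap _ _ _ _ (EFin \o K))// => z; rewrite lee_fin.
have iKs : (sf_product m m).-integrable setT (fun z => (K (swap_pair z))%:E).
  apply/integrableP; split.
    by apply: (measurableT_comp mK); exact: measurable_swap.
  under eq_integral do rewrite gee0_abs ?lee_fin//.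
  rewrite swapE; case/integrableP : iK => _.
  by under eq_integral do rewrite gee0_abs ?lee_fin//.
rewrite [X in _ = _ * X]Rintegral_mkcond -/K [in LHS]/Rintegral.
rewrite integral_mkcond hE.
under eq_integral do rewrite EFinB !EFinM.
rewrite integralB//; try exact: integrableZl.
have IK : (\int[sf_product m m]_z (K z)%:E)%E \is a fin_num.
  exact: integrable_fin_num iK.
by rewrite !integralZl// swapE fineB ?fin_numM// !fineM//= -mulrBl.
Qed.

Section temperature_test.
Context {R : realType} {d : nat}.
Local Notation phase := ('rV[R]_d * measurableTypeR R)%type.
Implicit Types (D : set 'rV[R]_d) (F : 'rV[R]_d -> R) (g : phase -> R).

Lemma L_weak_temperature D F (eta : R -> R) (p : 'rV[R]_d -> R -> R) g :
  L_weak D F eta p g (fun w => w.2) = 0.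
Proof.
have L0 xi w : L_integrand D F eta p g (fun w => w.2) xi w = 0.
  by rewrite /L_integrand subrr mulr0 !mul0r.
have inner0 xi :
    \int[dphase]_(w in Omega D) L_integrand D F eta p g (fun w => w.2) xi w = 0.
  by under eq_Rintegral do rewrite L0; rewrite /Rintegral integral0.
rewrite /L_weak; under eq_Rintegral do rewrite inner0.
by rewrite /Rintegral integral0.
Qed.

Definition temperature_drop F g (z : phase * phase) : R :=
  (z.1.2 - z.2.2) * chi F z.1.1 z.2.1 z.1.2 z.2.2 * g z.1 * g z.2.

Lemma temperature_drop_ge0 D F g : (forall w, Omega D w -> 0 <= g w) ->
  forall z, (Omega D `*` Omega D) z -> 0 <= temperature_drop F g z.
Proof.
move=> g0 z [D1 D2]; rewrite /temperature_drop mulr_ge0 ?g0// mulr_ge0 ?g0//.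
by rewrite /chi; case: andP => [[_ /ltW]|_]; rewrite ?mulr0// mulr1 subr_ge0.
Qed.

Lemma temperature_drop_swap F g z :
  temperature_drop F g z * temperature_drop F g (swap_pair z) = 0.
Proof.
rewrite /temperature_drop /chi /=.
have [Flt|_] := ltP (F z.1.1) (F z.2.1); last by rewrite /= !(mulr0, mul0r).
by rewrite (lt_gtF Flt) !(mulr0, mul0r).
Qed.

End temperature_test.

Theorem lemma3p1 (R : realType) (d : nat) (d_ge1 : (1 <= d)%N)
    (D : set 'rV[R]_d) (mD : measurable D)
    (F : 'rV[R]_d -> R) (cF : {within D, continuous F})
    (lambda mu : R) (lambda01 : 0 <= lambda <= 1) (mu01 : 0 <= mu <= 1)
    (mu_lt_lambda : mu < lambda)
    (sigma : 'rV[R]_d -> 'rV[R]_d -> R -> R -> R)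
    (dW : measure_display) (W : measurableType dW) (P : probability W R)
    (Z Zs : {RV P >-> R})
    (symZ : symmetric_rv Z) (symZs : symmetric_rv Zs)
    (meanZ : mean_zero Z) (meanZs : mean_zero Zs)
    (eta : R -> R) (p : 'rV[R]_d -> R -> R)
    (dens_p : forall T : R, 0 < T -> symmetric_density (fun xi => p xi T))
    (Phi : set ('rV[R]_d * measurableTypeR R -> R))
    (Phi_T : Phi (fun w => w.2))
    (f : R -> 'rV[R]_d * measurableTypeR R -> R)
    (sol_f : kinetic_solution D F lambda mu sigma Z Zs eta p Phi f)
    (t : R) (t_gt0 : 0 < t) :
  let rhs := (mu - lambda) *
    \int[dphase2]_(w in Omega D `*` Omega D)
      ((w.1.2 - w.2.2) * chi F w.1.1 w.2.1 w.1.2 w.2.2 *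
       f t w.1 * f t w.2) in
  is_derive t 1 (temperature_moment D f) rhs /\ rhs <= 0.
Proof.
move=> rhs; have [[_ g0 _] sol] := sol_f t t_gt0.
have [_ _ iQ der] := sol _ Phi_T.
have /andP[mu_ge0 _] := mu01.
have lambda_gt0 : 0 < lambda := le_lt_trans mu_ge0 mu_lt_lambda.
have mOmega : measurable (Omega D) by exact: measurableX.
have mOmega2 : measurable (Omega D `*` Omega D) by exact: measurableX.
pose k := temperature_drop F (f t).
pose a z := mu * k (swap_pair z) - lambda * k z.
pose b z := sigma z.1.1 z.2.1 z.1.2 z.2.2 * f t z.1 * f t z.2.
have QE u z : Q_integrand F lambda mu sigma Z Zs (f t) (fun w => w.2) u z =
    a z + b z * Z u.
  by rewrite /Q_integrand /a /b /k /temperature_drop /=; ring.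
have iab : (P \x dphase2)%E.-integrable (setT `*` (Omega D `*` Omega D))
    (fun uz => (a uz.2 + b uz.2 * Z uz.1)%:E).
  apply: eq_integrable iQ => //; last by move=> uz _; rewrite QE.
  exact: measurableX.
have [ia Eab] := expectation_Rintegral_affine_noise mOmega2 meanZ iab.
have Qrhs : Q_weak D F lambda mu sigma Z Zs (f t) (fun w => w.2) = rhs.
  rewrite /Q_weak; under eq_fun do under eq_Rintegral do rewrite QE.
  rewrite Eab; apply: integral_antisymmetrization => //.
    exact: temperature_drop_ge0.
  by move=> z _; exact: temperature_drop_swap.
split; first by move: der; rewrite L_weak_temperature add0r Qrhs.
rewrite /rhs mulr_le0_ge0 ?subr_le0 ?(ltW mu_lt_lambda)//.
by apply: Rintegral_ge0; exact: temperature_drop_ge0.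
Qed.
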